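(* Let $\mathcal{T}=(t_{ijkl})$ be a real $4$th-order $3$-dimensional symmetric tensor. Suppose that $|t_{ijkl}|=1$ for all $i,j,k,l\in\{1,2,3\}$, that $t_{iiii}=1$ for all $i\in\{1,2,3\}$, and that $t_{iijj}=1$ and $t_{iiij}t_{ijjj}=-1$ for all $i,j\in\{1,2,3\}$ with $i\neq j$. Then $\mathcal{T}$ is strictly copositive if and only if both of the following hold: (1) at least one of $t_{1123},t_{1223},t_{1233}$ equals $1$; (2) for all pairwise distinct $i,j,k\in\{1,2,3\}$, if $t_{iijk}=-1$ then $t_{iiij}+t_{iiik}\ge 0$.
   Context: A real $4$th-order $3$-dimensional tensor $\mathcal{T}=(t_{ijkl})$, $1\le i,j,k,l\le 3$, is symmetric if its entries are invariant under all permutations of the indices. For $x\in\mathbb{R}^3$, $\mathcal{T}x^4=\sum_{i,j,k,l=1}^3 t_{ijkl}x_ix_jx_kx_l$. $\mathcal{T}$ is strictly copositive if $\mathcal{T}x^4>0$ for every nonzero $x\in\mathbb{R}^3$ with all coordinates nonnegative. *)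

(* Defs.v *)
From HB Require Import structures.
From mathcomp Require Import all_boot all_order all_algebra all_fingroup.
From mathcomp Require Import reals.

Set Implicit Arguments.
Unset Strict Implicit.
Unset Printing Implicit Defensive.

Import Order.TTheory GRing.Theory Num.Theory.
Local Open Scope ring_scope.

Definition tensor4 (R : realType) (n : nat) : Type :=
  'I_n -> 'I_n -> 'I_n -> 'I_n -> R.

Definition tensor_entry (R : realType) (n : nat) (T : tensor4 R n)
    (idx : 'I_4 -> 'I_n) : R :=
  T (idx (inord 0)) (idx (inord 1)) (idx (inord 2)) (idx (inord 3)).

Definition symmetric_tensor (R : realType) (n : nat) (T : tensor4 R n) : Prop :=
  forall (idx : 'I_4 -> 'I_n) (s : 'S_4),
    tensor_entry T (fun a => idx (s a)) = tensor_entry T idx.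

Definition tensor_form (R : realType) (n : nat) (T : tensor4 R n)
    (x : 'rV[R]_n) : R :=
  \sum_(i < n) \sum_(j < n) \sum_(k < n) \sum_(l < n)
    T i j k l * x 0 i * x 0 j * x 0 k * x 0 l.

Definition strictly_copositive (R : realType) (n : nat) (T : tensor4 R n) : Prop :=
  forall x : 'rV[R]_n, x != 0 -> (forall i, 0 <= x 0 i) -> 0 < tensor_form T x.

(* The indices 1, 2, 3 of the informal notation, i.e. 0, 1, 2 in 'I_3. *)
Definition idx1 : 'I_3 := @Ordinal 3 0 isT.
Definition idx2 : 'I_3 := @Ordinal 3 1 isT.
Definition idx3 : 'I_3 := @Ordinal 3 2 isT.

(* Main.v *)
(** Write [a], [b], [c] for [t1112], [t2223], [t3331] and [p], [q], [r] for
    [t1123], [t1223], [t1233].  The form is [quartic a b c p q r], which is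
    nondecreasing in [p], [q], [r] on the nonnegative orthant.  Up to a
    permutation of the variables, the two conditions give [a = b = r = 1], and
    for [p = q = -1] the quartic is
      [(x + y - z)^4 + 8 (y^3 (z - x) + w)],
    where [w] is [z^3 x] or [x^3 z] according to the sign of [c].  This is
    clearly positive when [x <= z]; when [x = z + u] with [u > 0], it equals
    [(u - y)^4 + 8 u^3 y + 8 w].  Conversely, the quartic is negative at
    (1, 1, 1) if (1) fails, and at the point with i-th coordinate 4 and the other
    two equal to 1 if (2) fails at i. *)

Require Import Defs.
From HB Require Import structures.
From mathcomp Require Import all_boot all_order all_algebra all_fingroup.
From mathcomp Require Import reals.
From mathcomp Require Import ring lra.

Import Order.TTheory GRing.Theory Num.Theory.
Local Open Scope ring_scope.

(** The brackets are antisymmetric because [t1222 = -t1112], and likewise for the other pairs.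
    Orienting them along the cycle 1, 2, 3, 1 makes the family stable under rotation. *)
Definition quartic {R : realType} (a b c p q r x y z : R) : R :=
  x ^+ 4 + y ^+ 4 + z ^+ 4
  + 6 * (x ^+ 2 * y ^+ 2 + y ^+ 2 * z ^+ 2 + x ^+ 2 * z ^+ 2)
  + 4 * (a * (x ^+ 3 * y - x * y ^+ 3) + b * (y ^+ 3 * z - y * z ^+ 3)
         + c * (z ^+ 3 * x - z * x ^+ 3))
  + 12 * (x * y * z) * (p * x + q * y + r * z).

Lemma quartic_rot (R : realType) (a b c p q r x y z : R) :
  quartic a b c p q r x y z = quartic b c a q r p y z x.
Proof. by rewrite /quartic; ring. Qed.

(** Exchanging two variables reverses the cycle, so every sign flips and [b], [c] trade places. *)
Lemma quartic_swap (R : realType) (a b c p q r x y z : R) :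
  quartic a b c p q r x y z = quartic (- a) (- c) (- b) q p r y x z.
Proof. by rewrite /quartic; ring. Qed.

Lemma quartic_gt0 (R : realType) (c p q x y z : R) :
  c = 1 \/ c = -1 -> -1 <= p -> -1 <= q -> 0 <= x -> 0 <= y -> 0 <= z ->
  0 < x + y + z -> 0 < quartic 1 1 c p q 1 x y z.
Proof.
move=> c1 p1 q1 x0 y0 z0 xyz0.
have [w [w0 wxz wE]] : exists w, [/\ 0 <= w, (w = 0 -> x = 0 \/ z = 0) &
    quartic 1 1 c p q 1 x y z = (x + y - z) ^+ 4 + 8 * (y ^+ 3 * (z - x) + w)
      + 12 * (x * y * z) * ((p + 1) * x + (q + 1) * y)].
  case: c1 => ->; [exists (z ^+ 3 * x) | exists (x ^+ 3 * z)];
    (split; [by rewrite mulr_ge0 ?exprn_ge0 | | by rewrite /quartic; ring]);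
    by move/eqP; rewrite mulf_eq0 expf_eq0 /= => /orP[] /eqP; auto.
(* This is the excess over the worst case [p = q = -1]. *)
have t0 : 0 <= 12 * (x * y * z) * ((p + 1) * x + (q + 1) * y).
  by rewrite !mulr_ge0 ?addr_ge0 ?mulr_ge0 //; lra.
rewrite wE; apply: ltr_wpDr => // {t0 wE}.
have [zx|xz] := ltP z x; last first.
  have s0 : 0 <= (x + y - z) ^+ 4 by rewrite exprn_even_ge0.
  have v0 : 0 <= y ^+ 3 * (z - x) by rewrite mulr_ge0 ?exprn_ge0 ?subr_ge0.
  rewrite lt_neqAle; apply/andP; split; last by lra.
  (* If the sum vanished, so would each of its nonnegative terms, which forces [x = y = z = 0]. *)
  apply/eqP => e.
  have /eqP : (x + y - z) ^+ 4 = 0 by lra.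
  rewrite expf_eq0 /= => /eqP s.
  have /eqP : y ^+ 3 * (z - x) = 0 by lra.
  rewrite mulf_eq0 expf_eq0 /= => v.
  have {wxz} : x = 0 \/ z = 0 by apply: wxz; lra.
  by case=> ?; case/orP: v => /eqP ?; lra.
pose u := x - z.
have u0 : 0 < u by rewrite /u subr_gt0.
(* The identity [(u + y)^4 - (u - y)^4 = 8 u^3 y + 8 u y^3] absorbs the negative term
   [- 8 y^3 u]. *)
have -> : (x + y - z) ^+ 4 + 8 * (y ^+ 3 * (z - x) + w) =
    (u - y) ^+ 4 + 8 * (u ^+ 3 * y) + 8 * w by rewrite /u; ring.
apply: ltr_wpDr; first by rewrite mulr_ge0.
have [->|y1] := eqVneq y 0; first by rewrite subr0 !mulr0 addr0 exprn_gt0.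
apply: ltr_wpDl; first by rewrite exprn_even_ge0.
by rewrite !mulr_gt0 ?exprn_gt0 // lt_neqAle eq_sym y1.
Qed.

(** The pattern [a = c = -1] turns into [a = b = 1] when [x] and [y] are exchanged. *)
Lemma quartic_gt0_r1 (R : realType) (a b c p q x y z : R) :
  b = 1 \/ b = -1 -> c = 1 \/ c = -1 ->
  a = 1 /\ b = 1 \/ a = -1 /\ c = -1 -> -1 <= p -> -1 <= q ->
  0 <= x -> 0 <= y -> 0 <= z -> 0 < x + y + z ->
  0 < quartic a b c p q 1 x y z.
Proof.
move=> b1 c1 [] [-> e] p1 q1 x0 y0 z0 xyz0.
  by rewrite e; apply: quartic_gt0.
rewrite quartic_swap e opprK; apply: quartic_gt0; rewrite // 1?(addrC y) //.
by case: b1 => ->; [right | left; rewrite opprK].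
Qed.

Lemma quartic_gt0_signs (R : realType) (a b c p q r x y z : R) :
  a = 1 \/ a = -1 -> b = 1 \/ b = -1 -> c = 1 \/ c = -1 ->
  p = 1 \/ p = -1 -> q = 1 \/ q = -1 -> r = 1 \/ r = -1 ->
  p = 1 \/ q = 1 \/ r = 1 ->
  (p = -1 -> 0 <= a - c) -> (q = -1 -> 0 <= b - a) -> (r = -1 -> 0 <= c - b) ->
  0 <= x -> 0 <= y -> 0 <= z -> 0 < x + y + z ->
  0 < quartic a b c p q r x y z.
Proof.
move=> a1 b1 c1 p1 q1 r1 one hp hq hr x0 y0 z0 xyz0.
have ge_m1 (s : R) : s = 1 \/ s = -1 -> -1 <= s by case=> ->; lra.
have forced (s u v : R) : s = 1 \/ s = -1 -> (s = -1 -> 0 <= u - v) ->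
    u = -1 -> v = 1 -> s = 1.
  by case=> // e /(_ e) + eu ev; rewrite eu ev => ?; exfalso; lra.
have := forced _ _ _ p1 hp; have := forced _ _ _ q1 hq.
have := forced _ _ _ r1 hr => nr nq np.
(* If the signs are not all equal, exactly one of the pairs [(a, c)], [(b, a)], [(c, b)] is
   [(-1, 1)]. Its coefficient is then 1, and the third sign agrees with one of the pair, which gives
   one of the two patterns. If all signs are equal, any coefficient equal to 1 will do. *)
have : (r = 1 /\ (a = 1 /\ b = 1 \/ a = -1 /\ c = -1)) \/
       (p = 1 /\ (b = 1 /\ c = 1 \/ b = -1 /\ a = -1)) \/
       (q = 1 /\ (c = 1 /\ a = 1 \/ c = -1 /\ b = -1)).
  by clear -a1 b1 c1 one np nq nr; tauto.
case=> [[-> signs]|[[-> signs]|[-> signs]]].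
- by apply: quartic_gt0_r1 => //; exact: ge_m1.
- rewrite quartic_rot; apply: quartic_gt0_r1 => //; try exact: ge_m1.
  by rewrite addrC addrA.
- rewrite 2!quartic_rot; apply: quartic_gt0_r1 => //; try exact: ge_m1.
  by rewrite -addrA addrC.
Qed.

Lemma ord3_cases (i : 'I_3) : [\/ i = idx1, i = idx2 | i = idx3].
Proof.
by case: i => [[|[|[|//]]] ?]; [constructor 1|constructor 2|constructor 3];
  apply: val_inj.
Qed.

Section SymmetricTensor.
Variables (R : realType) (n : nat) (T : tensor4 R n).
Hypothesis Tsym : symmetric_tensor T.

(** Positions range over ['I_4], so the default of [nth] is never reached. *)
Let entry_tperm (a b : 'I_4) (i j k l : 'I_n) :
  let f (m : 'I_4) := nth i [:: i; j; k; l] m in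
  let g m := f (tperm a b m) in
  T (g (inord 0)) (g (inord 1)) (g (inord 2)) (g (inord 3)) = T i j k l.
Proof.
by move=> f g; have := Tsym f (tperm a b); rewrite /tensor_entry /f !inordK.
Qed.

Lemma symmetric_tensor_swap12 (i j k l : 'I_n) : T i j k l = T j i k l.
Proof.
have := entry_tperm (inord 0) (inord 1) i j k l.
by rewrite /= tpermL tpermR !tpermD -?val_eqE /= ?inordK.
Qed.

Lemma symmetric_tensor_swap23 (i j k l : 'I_n) : T i j k l = T i k j l.
Proof.
have := entry_tperm (inord 1) (inord 2) i j k l.
by rewrite /= tpermL tpermR !tpermD -?val_eqE /= ?inordK.
Qed.

Lemma symmetric_tensor_swap34 (i j k l : 'I_n) : T i j k l = T i j l k.
Proof.
have := entry_tperm (inord 2) (inord 3) i j k l.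
by rewrite /= tpermL tpermR !tpermD -?val_eqE /= ?inordK.
Qed.

End SymmetricTensor.

Theorem theorem3p2 (R : realType) (T : tensor4 R 3)
    (Tsym : symmetric_tensor T)
    (Tabs : forall i j k l : 'I_3, `|T i j k l| = 1)
    (Tdiag : forall i : 'I_3, T i i i i = 1)
    (Tiijj : forall i j : 'I_3, i != j -> T i i j j = 1)
    (Tiiij : forall i j : 'I_3, i != j -> T i i i j * T i j j j = -1) :
  strictly_copositive T <->
  ((T idx1 idx1 idx2 idx3 = 1 \/
    T idx1 idx2 idx2 idx3 = 1 \/
    T idx1 idx2 idx3 idx3 = 1) /\
   (forall i j k : 'I_3, i != j -> i != k -> j != k ->
      T i i j k = -1 -> 0 <= T i i i j + T i i i k)).
Proof.
have sgn i j k l : T i j k l = 1 \/ T i j k l = -1.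
  have /eqP := Tabs i j k l; rewrite eqr_norml ler01 andbT.
  by case/orP => /eqP; [left|right].
pose s12 := symmetric_tensor_swap12 _ _ _ Tsym.
pose s23 := symmetric_tensor_swap23 _ _ _ Tsym.
pose s34 := symmetric_tensor_swap34 _ _ _ Tsym.
have opp i j : i != j -> T i i i j = - T i j j j.
  by move=> /Tiiij; case: (sgn i j j j) => -> ?; lra.
(* Each rule swaps one adjacent inversion, so rewriting sorts the indices. *)
pose srt := (s12 idx2 idx1, s12 idx3 idx1, s12 idx3 idx2,
             (fun i => s23 i idx2 idx1), (fun i => s23 i idx3 idx1),
             (fun i => s23 i idx3 idx2),
             (fun i j => s34 i j idx2 idx1), (fun i j => s34 i j idx3 idx1),
             (fun i j => s34 i j idx3 idx2)).
pose a := T idx1 idx1 idx1 idx2; pose b := T idx2 idx2 idx2 idx3.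
pose c := T idx1 idx3 idx3 idx3.
pose p := T idx1 idx1 idx2 idx3; pose q := T idx1 idx2 idx2 idx3.
pose r := T idx1 idx2 idx3 idx3.
have ea : T idx1 idx2 idx2 idx2 = - a by rewrite /a opp // opprK.
have eb : T idx2 idx3 idx3 idx3 = - b by rewrite /b opp // opprK.
have ec : T idx1 idx1 idx1 idx3 = - c by rewrite /c opp.
have formE x : tensor_form T x =
    quartic a b c p q r (x 0 idx1) (x 0 idx2) (x 0 idx3).
  rewrite /tensor_form.
  have sum3 (F : 'I_3 -> R) : \sum_i F i = F idx1 + F idx2 + F idx3.
    rewrite !big_ord_recr big_ord0 /= add0r.
    by congr (F _ + F _ + F _); apply: val_inj.
  rewrite !sum3.
  rewrite !srt.
  rewrite !Tdiag !(Tiijj idx1 idx2, Tiijj idx1 idx3, Tiijj idx2 idx3) //.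
  rewrite ea eb ec -/a -/b -/c -/p -/q -/r /quartic.
  ring.
rewrite -/p -/q -/r.
split=> [cop|[h1 h2] x xn0 x0].
- have pos (u v w : R) : 0 < u -> 0 <= v -> 0 <= w ->
      0 < quartic a b c p q r u v w.
    move=> u0 v0 w0; pose x : 'rV[R]_3 := \row_i nth 0 [:: u; v; w] i.
    have := cop x; rewrite formE !mxE /=; apply.
      by apply/eqP => /rowP /(_ idx1); rewrite !mxE /= => ?; lra.
    by move=> i; rewrite mxE; case: (ord3_cases i) => -> /=; lra.
  split.
    (* The value at (1, 1, 1) is [21 + 12 (p + q + r)], which is -15 if all three are -1. *)
    have := pos 1 1 1 ltr01 ler01 ler01; rewrite /quartic.
    have := sgn idx1 idx1 idx2 idx3; have := sgn idx1 idx2 idx2 idx3.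
    have := sgn idx1 idx2 idx3 idx3; rewrite -/p -/q -/r.
    by case=> ? [] ? [] ?; lra.
  have le1 i j k l : T i j k l <= 1 by rewrite -[leRHS](Tabs i j k l) ler_norm.
  have p1 : p <= 1 by exact: le1.
  have q1 : q <= 1 by exact: le1.
  have r1 : r <= 1 by exact: le1.
  (* A difference of two signs is -2, 0 or 2. *)
  have diff_ge0 i j k l i' j' k' l' : -2 < T i j k l - T i' j' k' l' ->
      0 <= T i j k l - T i' j' k' l'.
    by case: (sgn i j k l) => ->; case: (sgn i' j' k' l') => ->; lra.
  have hp : p = -1 -> 0 <= a - c.
    move=> pE; apply: diff_ge0; rewrite -/a -/c.
    (* With [p = -1], the value at (4, 1, 1) is [264 + 48 (q + r) + 240 (a - c)], at most
       [360 + 240 (a - c)]; this excludes [a - c = -2]. *)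
    by have := pos 4 1 1 (ltr0n _ 4) ler01 ler01; rewrite /quartic pE; lra.
  have hq : q = -1 -> 0 <= b - a.
    move=> qE; apply: diff_ge0; rewrite -/a -/b.
    by have := pos 1 4 1 ltr01 (ler0n _ 4) ler01; rewrite /quartic qE; lra.
  have hr : r = -1 -> 0 <= c - b.
    move=> rE; apply: diff_ge0; rewrite -/b -/c.
    by have := pos 1 1 4 ltr01 ler01 (ler0n _ 4); rewrite /quartic rE; lra.
  move=> i j k; case: (ord3_cases i) => ->; case: (ord3_cases j) => ->;
    case: (ord3_cases k) => -> //= _ _ _;
  rewrite ?srt ?ea ?eb ?ec -/a -/b -/c -/p -/q -/r; lra.
- have [hp hq hr] : [/\ p = -1 -> 0 <= a - c, q = -1 -> 0 <= b - a &
      r = -1 -> 0 <= c - b].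
    have := h2 idx3 idx1 idx2 isT isT isT; have := h2 idx2 idx1 idx3 isT isT isT.
    have := h2 idx1 idx2 idx3 isT isT isT.
    rewrite !srt ea eb ec -/a -/b -/c -/p -/q -/r => hp hq hr.
    by split=> [/hp|/hq|/hr] //; rewrite addrC.
  rewrite formE; apply: quartic_gt0_signs => //; try exact: sgn.
  rewrite lt_neqAle !addr_ge0 // andbT eq_sym; apply: contra xn0.
  rewrite !paddr_eq0 ?addr_ge0 // => /andP[/andP[/eqP e1 /eqP e2] /eqP e3].
  by apply/eqP/rowP => i; rewrite mxE; case: (ord3_cases i) => ->.
Qed.
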